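(* Let $P$ be a probability measure over $\mathbb{R}^d$. Let $(\alpha_n)$ be a sequence in $[0,1)$ that converges to one and let $(u_n)$ be a sequence in $\mathcal{S}^{d-1}$. Assume that, for any accumulation point $u_*$ of $(u_n)$, $P$ is not concentrated on a line with direction $u_*$ or $$\int_{\mathbb{R}^d}(\|z\|+u_*'z)\,dP(z)=\infty.$$ Then, for any sequence $(\mu_{\alpha_n,u_n})$ such that, for each $n$, $\mu_{\alpha_n,u_n}$ is a spatial quantile of order $\alpha_n$ in direction $u_n$ for $P$, one has $\|\mu_{\alpha_n,u_n}\|\to\infty$ as $n\to\infty$.
   Context: $\|\cdot\|$ is the Euclidean norm on $\mathbb{R}^d$, $x'y$ is the Euclidean inner product, and $\mathcal{S}^{d-1}=\{z\in\mathbb{R}^d:\|z\|=1\}$ is the unit sphere. For a probability measure $P$ over $\mathbb{R}^d$, $\alpha\in[0,1)$ and $u\in\mathcal{S}^{d-1}$, a point $\mu_{\alpha,u}\in\mathbb{R}^d$ is a spatial quantile of order $\alpha$ in direction $u$ for $P$ if and only if it minimizes over $\mathbb{R}^d$ the objective function $\mu\mapsto O^P_{\alpha,u}(\mu):=\int_{\mathbb{R}^d}\{\|z-\mu\|-\|z\|-\alpha u'\mu\}\,dP(z)$ (such minimizers need not be unique). $P$ is concentrated on a line with direction $u_*\in\mathcal{S}^{d-1}$ if and only if there exists $z_0\in\mathbb{R}^d$ such that $P[\{z_0+\lambda u_*:\lambda\in\mathbb{R}\}]=1$. An accumulation point of a sequence is the limit of some subsequence. The integrand $\|z\|+u_*'z$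 is nonnegative, so its integral is well defined in $[0,\infty]$. *)

(* Defs.v *)
From HB Require Import structures.
From mathcomp Require Import all_boot all_order all_algebra.
From mathcomp Require Import all_classical all_reals all_analysis.
Import Order.TTheory GRing.Theory Num.Theory.
Import numFieldNormedType.Exports.

Set Implicit Arguments.
Unset Strict Implicit.
Unset Printing Implicit Defensive.

Local Open Scope classical_set_scope.
Local Open Scope ring_scope.

(* R^d with its Borel sigma-algebra; as a type it is convertible to the row
   vectors 'rV[R]_d, whose library topology is the usual one. *)
Notation borel_rV R d := (g_sigma_algebraType (@open 'rV[R]_d)).

Definition dot (R : realType) (d : nat) (x y : 'rV[R]_d) : R :=
  \sum_(i < d) x 0 i * y 0 i.

(* The library norm `|x| on 'rV[R]_d is the sup norm. *)
Definition enorm (R : realType) (d : nat) (x : 'rV[R]_d) : R :=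
  Num.sqrt (dot x x).

Definition sphere (R : realType) (d : nat) : set 'rV[R]_d :=
  [set z | enorm z = 1].
Arguments sphere : clear implicits.

(* The integrand is bounded in z (by (1 + alpha) times the norm of mu when u is
   a unit vector), so the extended-real integral is always finite here. *)
Definition quantile_objective (R : realType) (d : nat)
    (P : probability (borel_rV R d) R) (alpha : R) (u mu : 'rV[R]_d) : \bar R :=
  (\int[P]_z (enorm ((z : 'rV[R]_d) - mu) - enorm (z : 'rV[R]_d)
              - alpha * dot u mu)%:E)%E.

Definition spatial_quantile (R : realType) (d : nat)
    (P : probability (borel_rV R d) R) (alpha : R) (u mu : 'rV[R]_d) : Prop :=
  forall nu : 'rV[R]_d,
    (quantile_objective P alpha u mu <= quantile_objective P alpha u nu)%E.

Definition line (R : realType) (d : nat) (z0 u : 'rV[R]_d) : set 'rV[R]_d :=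
  [set z0 + l *: u | l in [set: R]].

Definition concentrated_on_line (R : realType) (d : nat)
    (P : probability (borel_rV R d) R) (u : 'rV[R]_d) : Prop :=
  exists z0 : 'rV[R]_d, P (line z0 u) = 1%E.

Definition accumulation_point (T : topologicalType) (v : nat -> T) (l : T) :
    Prop :=
  exists2 phi : nat -> nat,
    {homo phi : m n / (m < n)%N} & v (phi n) @[n --> \oo] --> l.

(* Main.v *)
Require Import Defs.
From HB Require Import structures.
From mathcomp Require Import all_boot all_order all_algebra.
From mathcomp Require Import all_classical all_reals all_analysis.
From mathcomp Require Import measurable_realfun ring lra.
Import Order.TTheory GRing.Theory Num.Theory.
Import numFieldNormedType.Exports.

Set Implicit Arguments.
Unset Strict Implicit.
Unset Printing Implicit Defensive.

Local Open Scope classical_set_scope.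
Local Open Scope ring_scope.

(** The proof is a compactness argument. If the norms of the quantiles [mu n]
    did not tend to infinity, infinitely many of them would stay in a bounded
    set, and along a common subsequence [u n] would converge to a unit vector
    [us] and [mu n] to a point [ms] ([compact_subsequence]).

    For each [n], compare the objective at its minimizer [mu n] with its value
    at [mu n + u n], one unit further in the direction [u n]. The difference
    is the integral of [|z - mu n - u n| - |z - mu n| - alpha n], and it is
    nonnegative by minimality ([quantile_increment_ge0]). These integrands are
    bounded by 2, so dominated convergence lets [n] tend to infinity: the
    integral of [|z - ms - us| - |z - ms| - 1] is nonnegative
    ([limit_increment_ge0]). By the triangle inequality this last integrand is
    nonpositive, so it vanishes [P]-almost everywhere. Equality in the triangle
    inequality forces [z - ms] to be a nonpositive multiple of [us]
    ([enormB_eqD]): [P] lives on the half-line issued from [ms] with direction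
    [- us] ([ae_halfline]).

    Both alternatives of the assumption now fail at the accumulation point
    [us]. The half-line lies in a line with direction [us], and on it
    [|z| + us'z] is at most [2 |ms|], because the growth of [|z|] is
    compensated by the decrease of [us'z]. *)

(** * Euclidean inner product and norm *)

Lemma dotC (R : realType) (d : nat) (x y : 'rV[R]_d) : dot x y = dot y x.
Proof. by apply: eq_bigr => i _; rewrite mulrC. Qed.

Lemma dotDl (R : realType) (d : nat) (x y z : 'rV[R]_d) :
  dot (x + y) z = dot x z + dot y z.
Proof. by rewrite -big_split; apply: eq_bigr => i _; rewrite mxE mulrDl. Qed.

Lemma dotZl (R : realType) (d : nat) (a : R) (x z : 'rV[R]_d) :
  dot (a *: x) z = a * dot x z.
Proof. by rewrite mulr_sumr; apply: eq_bigr => i _; rewrite mxE mulrA. Qed.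

Lemma dotDr (R : realType) (d : nat) (x y z : 'rV[R]_d) :
  dot z (x + y) = dot z x + dot z y.
Proof. by rewrite dotC dotDl !(dotC z). Qed.

Lemma dotZr (R : realType) (d : nat) (a : R) (x z : 'rV[R]_d) :
  dot z (a *: x) = a * dot z x.
Proof. by rewrite dotC dotZl (dotC z). Qed.

Lemma dotNl (R : realType) (d : nat) (x z : 'rV[R]_d) :
  dot (- x) z = - dot x z.
Proof. by rewrite -scaleN1r dotZl mulN1r. Qed.

Lemma dotNr (R : realType) (d : nat) (x z : 'rV[R]_d) :
  dot z (- x) = - dot z x.
Proof. by rewrite dotC dotNl (dotC z). Qed.

Lemma dot_ge0 (R : realType) (d : nat) (x : 'rV[R]_d) : 0 <= dot x x.
Proof. by apply: sumr_ge0 => i _; rewrite -expr2 sqr_ge0. Qed.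

Lemma dot_eq0 (R : realType) (d : nat) (x : 'rV[R]_d) : dot x x = 0 -> x = 0.
Proof.
move=> /eqP; rewrite psumr_eq0 => [/allP x0|i _]; last first.
  by rewrite -expr2 sqr_ge0.
apply/rowP => i; rewrite mxE; apply/eqP.
by have := x0 i (mem_index_enum i); rewrite /= mulf_eq0 orbb.
Qed.

Lemma enorm_ge0 (R : realType) (d : nat) (x : 'rV[R]_d) : 0 <= enorm x.
Proof. exact: sqrtr_ge0. Qed.

Lemma sqr_enorm (R : realType) (d : nat) (x : 'rV[R]_d) :
  enorm x ^+ 2 = dot x x.
Proof. by rewrite sqr_sqrtr // dot_ge0. Qed.

Lemma enormN (R : realType) (d : nat) (x : 'rV[R]_d) : enorm (- x) = enorm x.
Proof. by rewrite /enorm dotNl dotNr opprK. Qed.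

Lemma coord_le_enorm (R : realType) (d : nat) (x : 'rV[R]_d) (i : 'I_d) :
  `|x 0 i| <= enorm x.
Proof.
rewrite -sqrtr_sqr ler_wsqrtr// /dot (bigD1 i)//= -expr2 lerDl.
by apply: sumr_ge0 => j _; rewrite -expr2 sqr_ge0.
Qed.

(** Cauchy-Schwarz, from the nonnegativity of the square of
    [(y'y) x - (x'y) y], which avoids any division. *)
Lemma dot_le_enorm (R : realType) (d : nat) (x y : 'rV[R]_d) :
  dot x y <= enorm x * enorm y.
Proof.
have [y0|yN0] := eqVneq (dot y y) 0.
  by rewrite (dot_eq0 y0) -(scale0r y) dotZr mul0r mulr_ge0 ?enorm_ge0.
have y_gt0 : 0 < dot y y by rewrite lt_neqAle eq_sym yN0 dot_ge0.
have := dot_ge0 (dot y y *: x - dot x y *: y).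
rewrite !(dotDl, dotDr, dotNl, dotNr, dotZl, dotZr) (dotC y x) => h.
have {h} : 0 <= dot y y * (dot x x * dot y y - dot x y ^+ 2) by lra.
rewrite pmulr_rge0// subr_ge0 -!sqr_enorm -exprMn => h.
apply: le_trans (ler_norm _) _.
by rewrite -(ler_pXn2r (n := 2))// ?nnegrE ?mulr_ge0 ?enorm_ge0 //
        real_normK ?num_real.
Qed.

Lemma enormD (R : realType) (d : nat) (x y : 'rV[R]_d) :
  enorm (x + y) <= enorm x + enorm y.
Proof.
rewrite -(ler_pXn2r (n := 2))// ?nnegrE ?addr_ge0 ?enorm_ge0//.
rewrite sqr_enorm dotDl !dotDr (dotC y x) -!sqr_enorm sqrrD.
have := dot_le_enorm x y; lra.
Qed.

(** This bounds the integrands of the objective functions uniformly in the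
    integration variable, although [enorm] itself may fail to be integrable. *)
Lemma enorm_distD (R : realType) (d : nat) (x y : 'rV[R]_d) :
  `|enorm (x - y) - enorm x| <= enorm y.
Proof.
have := enormD x (- y); have := enormD (x - y) y.
rewrite subrK enormN ler_norml; lra.
Qed.

(** Equality case of the triangle inequality: squaring the hypothesis gives
    [w'u = - |w|], and then [w + |w| u] has zero norm. *)
Lemma enormB_eqD (R : realType) (d : nat) (w u : 'rV[R]_d) :
  enorm u = 1 -> enorm (w - u) = enorm w + 1 -> w = - (enorm w *: u).
Proof.
move=> u1 /(congr1 (fun t => t ^+ 2)); rewrite sqr_enorm sqrrD.
rewrite !(dotDl, dotDr, dotNl, dotNr) -!sqr_enorm (dotC u w) u1 => h.
have {}h : dot w u = - enorm w by lra.
apply/eqP; rewrite -subr_eq0 opprK; apply/eqP/dot_eq0.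
rewrite !(dotDl, dotDr, dotZl, dotZr) (dotC u w) -!sqr_enorm u1 h; ring.
Qed.

(** * Convergence, measurability and compactness *)

Lemma cvg_dot (R : realType) (d : nat) (T : Type) (F : set_system T)
    (FF : Filter F) (f g : T -> 'rV[R]_d) (a b : 'rV[R]_d) :
  f t @[t --> F] --> a -> g t @[t --> F] --> b ->
  dot (f t) (g t) @[t --> F] --> dot a b.
Proof.
move=> fa gb; rewrite /dot.
apply: cvg_big => [|i _]; first exact: add_continuous.
apply: cvgM.
  by apply: (cvg_comp f (fun x : 'rV[R]_d => x 0 i) fa); exact: coord_continuous.
by apply: (cvg_comp g (fun x : 'rV[R]_d => x 0 i) gb); exact: coord_continuous.
Qed.

Lemma cvg_enorm (R : realType) (d : nat) (T : Type) (F : set_system T)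
    (FF : Filter F) (f : T -> 'rV[R]_d) (a : 'rV[R]_d) :
  f t @[t --> F] --> a -> enorm (f t) @[t --> F] --> enorm a.
Proof.
move=> fa; have dot_ff := cvg_dot FF fa fa.
apply: (cvg_comp (fun t => dot (f t) (f t)) Num.sqrt dot_ff).
exact: sqrt_continuous.
Qed.

(** The sigma-algebra on the domain is the one generated by the open sets, so
    preimages of open intervals, which generate the Borel sets of [R], are
    among its generators. *)
Lemma continuous_measurable_borel (R : realType) (d : nat) (f : 'rV[R]_d -> R) :
  continuous f -> measurable_fun [set: borel_rV R d] (f : borel_rV R d -> R).
Proof.
move=> /continuousP cf.
apply: (measurability _ (RGenOpens.measurableE R)) => _ [_ [a [b ->]] <-].
by rewrite setTI; apply: sub_sigma_algebra; exact/cf/interval_open.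
Qed.

(** Sequential compactness for a sequence that is only frequently in the
    compact set. The limit is a cluster point of the filter of the tails
    restricted to the indices at which the sequence is in [A]. *)
Lemma compact_subsequence (R : realType) (V : pseudoMetricType R) (A : set V)
    (w : nat -> V) :
  compact A -> (forall N, exists2 n, (N <= n)%N & A (w n)) ->
  exists l, accumulation_point w l.
Proof.
move=> cA Aw.
pose F := filter_from [set: nat]
  (fun N => [set w n | n in [set n | (N <= n)%N /\ A (w n)]]).
have FF : ProperFilter F.
  apply: filter_from_proper => [|N _]; last first.
    by have [n Nn An] := Aw N; exists (w n); exists n.
  apply: filter_from_filter => [|i j _ _]; first by exists 0%N.
  exists (maxn i j) => // _ [n [+ An] <-]; rewrite geq_max => /andP[ni nj].
  by split; exists n.
have FA : F A by exists 0%N => // _ [n [_ An] <-].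
have [l [_ Fl]] := cA F FF FA; exists l.
have step N k : {n | (N < n)%N & ball l k.+1%:R^-1 (w n)}.
  apply/cid2.
  have [] := Fl [set w n | n in [set n | (N < n)%N /\ A (w n)]]
                (ball l k.+1%:R^-1).
  - by exists N.+1.
  - by apply: nbhsx_ballx; rewrite invr_gt0.
  - by move=> _ [[n [Nn _] <-] bn]; exists n.
(* The indices increase strictly while the k-th term is within 1/(k+1) of l. *)
pose phi := fix phi k := if k is k'.+1 then s2val (step (phi k') k) else
  s2val (step 0%N 0%N).
have phiS k : (phi k < phi k.+1)%N by exact: (s2valP (step (phi k) k.+1)).
have bphi k : ball l k.+1%:R^-1 (w (phi k)).
  by case: k => [|k]; [exact: (s2valP' (step 0 0)%N)|
                      exact: (s2valP' (step (phi k) k.+1))].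
exists phi; first by apply: homo_ltn => //; exact: ltn_trans.
apply/cvg_ballP => e e0; near=> k.
apply: le_ball (bphi k); apply/ltW; near: k.
exact: (near_infty_natSinv_lt (PosNum e0)).
Unshelve. all: by end_near. Qed.

(** Compactness is available for products of segments, that is, for balls of
    the sup norm, which contain the Euclidean balls. *)
Definition cube (R : realType) (d : nat) (M : R) : set 'rV[R]_d :=
  [set v | forall i, v ord0 i \in `[- M, M]].
Arguments cube : clear implicits.

Lemma compact_cube (R : realType) (d : nat) (M : R) : compact (cube R d M).
Proof.
apply: (@rV_compact _ _ (fun=> `[- M, M]%classic)) => _.
exact: segment_compact.
Qed.

Lemma enorm_le_cube (R : realType) (d : nat) (M : R) (x : 'rV[R]_d) :
  enorm x <= M -> cube R d M x.
Proof.
by move=> xM i; rewrite in_itv /= -ler_norml (le_trans (coord_le_enorm _ _)).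
Qed.

(** * The increment of the objective function between two points *)

Section Objective.
Context (R : realType) (d : nat) (P : probability (borel_rV R d) R).

Lemma enormB_continuous (mu : 'rV[R]_d) :
  continuous (fun z : 'rV[R]_d => enorm (z - mu)).
Proof.
move=> z; exact: (cvg_enorm _ (cvgB cvg_id (cvg_cst mu))).
Qed.

Lemma measurable_enormB (mu : 'rV[R]_d) :
  measurable_fun [set: borel_rV R d]
    (fun z : borel_rV R d => enorm ((z : 'rV[R]_d) - mu)).
Proof. by apply: continuous_measurable_borel; exact: enormB_continuous. Qed.

Lemma integrable_enorm_diff (mu nu : 'rV[R]_d) (c : R) :
  P.-integrable [set: borel_rV R d]
    (EFin \o (fun z : borel_rV R d =>
      enorm ((z : 'rV[R]_d) - nu) - enorm ((z : 'rV[R]_d) - mu) - c)).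
Proof.
apply: measurable_bounded_integrable => //.
- by apply: le_lt_trans (ltry 1); exact: probability_le1.
- apply: measurable_funB => //.
  by apply: measurable_funB; exact: measurable_enormB.
- exists (enorm (nu - mu) + `|c|); split; first exact: num_real.
  move=> x /ltW Mx z _; apply: le_trans _ Mx.
  apply: le_trans (ler_normB _ _) _; rewrite lerD2r.
  have := enorm_distD ((z : 'rV[R]_d) - mu) (nu - mu).
  by rewrite opprB addrA subrK.
Qed.

(** The terms [- |z|] of the two objectives cancel, which turns minimality into
    a statement on a single integral. The subtraction of the two extended-real
    integrals is legitimate because both are finite. *)
Lemma quantile_increment_ge0 (alpha : R) (u mu nu : 'rV[R]_d) :
  spatial_quantile P alpha u mu ->
  (0 <= \int[P]_z (enorm ((z : 'rV[R]_d) - nu) - enorm ((z : 'rV[R]_d) - mu)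
                   - alpha * dot u (nu - mu))%:E)%E.
Proof.
move=> /(_ nu); rewrite /quantile_objective => le_munu.
have int m : P.-integrable [set: borel_rV R d] (EFin \o (fun z : borel_rV R d =>
    enorm ((z : 'rV[R]_d) - m) - enorm (z : 'rV[R]_d) - alpha * dot u m)).
  have := integrable_enorm_diff 0 m (alpha * dot u m).
  by under eq_fun do rewrite subr0.
rewrite [leRHS](_ : _ = \int[P]_z (
    (enorm ((z : 'rV[R]_d) - nu) - enorm (z : 'rV[R]_d) - alpha * dot u nu)%:E
  - (enorm ((z : 'rV[R]_d) - mu) - enorm (z : 'rV[R]_d) - alpha * dot u mu)%:E))%E;
    last first.
  by apply: eq_integral => z _; rewrite -EFinB dotDr dotNr; congr EFin; ring.
rewrite integralB_EFin// sube_ge0//.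
by rewrite (integrable_fin_num measurableT (int mu)).
Qed.

End Objective.

(** * Limits of quantiles as the order tends to one *)

Section Limit.
Context (R : realType) (d : nat) (P : probability (borel_rV R d) R).
Context (alpha : nat -> R) (u mu : nat -> 'rV[R]_d) (us ms : 'rV[R]_d).
Context (alpha01 : forall n, 0 <= alpha n < 1).
Context (alpha_cvg : alpha n @[n --> \oo] --> (1 : R)).
Context (u_unit : forall n, enorm (u n) = 1).
Context (u_cvg : u n @[n --> \oo] --> us).
Context (mu_cvg : mu n @[n --> \oo] --> ms).
Context (mu_quantile : forall n, spatial_quantile P (alpha n) (u n) (mu n)).

Lemma enorm_limit_unit : enorm us = 1.
Proof.
have lim_enorm : enorm (u n) @[n --> \oo] --> enorm us.
  exact: cvg_enorm u_cvg.
have lim_1 : enorm (u n) @[n --> \oo] --> (1 : R).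
  by under eq_fun do rewrite u_unit; exact: cvg_cst.
exact: (cvg_unique (@Rhausdorff R) lim_enorm lim_1).
Qed.

(** The integrand of [quantile_increment_ge0] from [mu n] to [mu n + u n]: its
    linear term is [alpha n] because [u n] is a unit vector. *)
Let incr n (z : borel_rV R d) : R :=
  enorm ((z : 'rV[R]_d) - (mu n + u n)) - enorm ((z : 'rV[R]_d) - mu n)
  - alpha n.

Let limit_incr (z : borel_rV R d) : R :=
  enorm ((z : 'rV[R]_d) - (ms + us)) - enorm ((z : 'rV[R]_d) - ms) - 1.

Lemma limit_increment_ge0 : (0 <= \int[P]_z (limit_incr z)%:E)%E.
Proof.
have int2 : P.-integrable [set: borel_rV R d] (EFin \o cst 2).
  exact: finite_measure_integrable_cst.
have [|||||_ _ cvg_int] := @dominated_convergence _ _ _ P setT measurableT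
    (fun n => EFin \o incr n) (EFin \o limit_incr) (EFin \o cst 2).
- move=> n; rewrite /incr.
  have int_n := integrable_enorm_diff P (mu n) (mu n + u n) (alpha n).
  by have := measurable_int P int_n.
- by have := measurable_int P (integrable_enorm_diff P ms (ms + us) 1).
- apply: aeW => z _; apply: cvg_EFin; first by near=> n.
  apply: cvgB => //; apply: cvgB; apply: cvg_enorm; apply: cvgB => //;
    [exact: cvg_cst|exact: cvgD|exact: cvg_cst].
- exact: int2.
- apply: aeW => z n _; rewrite /= lee_fin.
  have := enorm_distD ((z : 'rV[R]_d) - mu n) (u n).
  have := alpha01 n.
  by rewrite u_unit -addrA -opprD /incr !ler_norml => /andP[? ?] /andP[? ?]; lra.
rewrite -(cvg_lim _ cvg_int)//; apply: lime_ge.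
  by apply/cvg_ex; eexists; exact: cvg_int.
apply: nearW => n; have := quantile_increment_ge0 (mu n + u n) (mu_quantile n).
by rewrite (addrC (mu n)) addrK -sqr_enorm u_unit expr1n mulr1 (addrC (u n)).
Unshelve. all: by end_near. Qed.

(** The limit integrand is nonpositive with a nonnegative integral, hence
    almost everywhere zero, and its zeros are the points at which the triangle
    inequality is an equality. *)
Lemma ae_halfline : {ae P, forall z : borel_rV R d,
  (z : 'rV[R]_d) - ms = - (enorm ((z : 'rV[R]_d) - ms) *: us)}.
Proof.
have incr_le0 z : limit_incr z <= 0.
  have := enorm_distD ((z : 'rV[R]_d) - ms) us.
  rewrite enorm_limit_unit -addrA -opprD ler_norml /limit_incr => /andP[_ ?].
  lra.
have intf := integrable_enorm_diff P ms (ms + us) 1.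
have mf := measurable_int P intf.
have /(ae_eq_integral_abs P measurableT mf) :
    (\int[P]_z `|(limit_incr z)%:E| = 0)%E.
  apply/eqP; rewrite eq_le integral_ge0// andbT.
  rewrite (_ : integral _ _ _ = - \int[P]_z (limit_incr z)%:E)%E.
    by rewrite oppe_le0 limit_increment_ge0.
  rewrite -integralN; last exact: integrable_add_def intf.
  by apply: eq_integral => z _; rewrite /= ler0_norm.
apply: filterS => z /(_ I) [incr_z]; apply: (enormB_eqD enorm_limit_unit).
by rewrite -addrA -opprD; move: incr_z; rewrite /limit_incr; lra.
Qed.

End Limit.

(** * Probabilities carried by a half-line *)

Section Line.
Context (R : realType) (d : nat) (P : probability (borel_rV R d) R).
Context (us ms : 'rV[R]_d).
Context (us_unit : enorm us = 1).

(** For a unit direction, a point is on the line when it is equal to its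
    orthogonal projection; this exhibits the line as the zero set of a
    continuous function, hence as a Borel set. *)
Lemma lineE :
  line ms us = [set z | enorm (z - ms - dot (z - ms) us *: us) = 0].
Proof.
apply/seteqP; split => [_ [l _ <-]|z /= /(congr1 (fun t => t ^+ 2))].
  rewrite /= (addrC ms) addrK dotZl -sqr_enorm us_unit expr1n mulr1 subrr.
  by rewrite /enorm -(scale0r us) dotZl mul0r sqrtr0.
rewrite sqr_enorm expr0n => /dot_eq0/eqP; rewrite subr_eq0 => /eqP z_ms.
by exists (dot (z - ms) us) => //; rewrite -z_ms addrC subrK.
Qed.

Lemma measurable_line : measurable (line ms us : set (borel_rV R d)).
Proof.
have cont : continuous
    (fun z : 'rV[R]_d => enorm (z - ms - dot (z - ms) us *: us)).
  move=> z; have z_ms : (t - ms) @[t --> z] --> z - ms.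
    exact: (cvgB cvg_id (cvg_cst ms)).
  apply: (cvg_enorm _ (cvgB z_ms (cvgZ _ (cvg_cst us)))).
  exact: (cvg_dot _ z_ms (cvg_cst us)).
have := continuous_measurable_borel cont measurableT (measurable_set1 (0 : R)).
by rewrite setTI lineE.
Qed.

Context (halfline : {ae P, forall z : borel_rV R d,
  (z : 'rV[R]_d) - ms = - (enorm ((z : 'rV[R]_d) - ms) *: us)}).

Lemma ae_halfline_concentrated : concentrated_on_line P us.
Proof.
exists ms; have mL := measurable_line.
have /(negligibleP P (measurableC mL)) PL : P.-negligible (~` line ms us).
  apply: (filterS _ halfline) => z zE.
  exists (- enorm ((z : 'rV[R]_d) - ms)) => //.
  by rewrite scaleNr -zE addrC subrK.
by rewrite -[line _ _]setCK (probability_setC P (measurableC mL)) PL sube0.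
Qed.

(** If [z = ms - t us] with [t >= 0], then [|z| <= |ms| + t] while
    [us'z = us'ms - t <= |ms| - t], so that the sum is at most [2 |ms|]. *)
Lemma ae_halfline_finite_integral :
  (\int[P]_z (enorm (z : 'rV[R]_d) + dot us (z : 'rV[R]_d))%:E < +oo)%E.
Proof.
have ge0 (z : 'rV[R]_d) : 0 <= enorm z + dot us z.
  have := dot_le_enorm (- us) z; rewrite dotNl enormN us_unit; lra.
have cont : continuous (fun z : 'rV[R]_d => enorm z + dot us z).
  move=> z; have cvgz : t @[t --> z] --> z by exact: cvg_id.
  exact: (cvgD (cvg_enorm _ cvgz) (cvg_dot _ (cvg_cst us) cvgz)).
have M_ge0 : 0 <= enorm ms + enorm ms by rewrite addr_ge0 ?enorm_ge0.
apply: (@le_lt_trans _ _ (\int[P]_z (enorm ms + enorm ms)%:E)%E); last first.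
  have intM :=
    finite_measure_integrable_cst P (enorm ms + enorm ms) measurableT.
  by rewrite ltey_eq (integrable_fin_num measurableT intM).
apply: (ae_ge0_le_integral measurableT) => //.
- by move=> z _; rewrite lee_fin.
- by apply/measurable_EFinP; exact: (continuous_measurable_borel cont).
- apply: filterS halfline => z zE _; rewrite lee_fin.
  have := dot_le_enorm us ms; rewrite us_unit mul1r => dot_le.
  have := enormD ((z : 'rV[R]_d) - ms) ms; rewrite subrK.
  have /(congr1 (dot us)) := zE.
  rewrite dotDr !dotNr dotZr -sqr_enorm us_unit; lra.
Qed.

End Line.

Theorem theorem2 (R : realType) (d : nat)
    (P : probability (borel_rV R d) R)
    (alpha : nat -> R) (u : nat -> 'rV[R]_d)
    (alpha_ge0_lt1 : forall n, 0 <= alpha n < 1)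
    (alpha_cvg1 : alpha n @[n --> \oo] --> (1 : R))
    (u_sphere : forall n, sphere R d (u n))
    (P_acc : forall ustar : 'rV[R]_d, accumulation_point u ustar ->
       ~ concentrated_on_line P ustar \/
       (\int[P]_z (enorm (z : 'rV[R]_d) + dot ustar (z : 'rV[R]_d))%:E = +oo)%E)
    (mu : nat -> 'rV[R]_d)
    (mu_quantile : forall n, spatial_quantile P (alpha n) (u n) (mu n)) :
  enorm (mu n) @[n --> \oo] --> +oo.
Proof.
apply/cvgryPge => M; apply: contrapT => not_large.
have bounded N : exists2 n, (N <= n)%N & enorm (mu n) <= M.
  apply: contrapT => no; apply: not_large; exists N => // n /= Nn.
  by rewrite leNgt; apply/negP => /ltW muM; apply: no; exists n.
(* One subsequence for the pairs, so that both components converge. *)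
have [||[us ms] [phi phi_incr cvg_pair_phi]] :=
  compact_subsequence (A := cube R d 1 `*` cube R d M)
    (w := fun n => (u n, mu n)).
- by apply: compact_setX; exact: compact_cube.
- move=> N; have [n Nn muM] := bounded N; exists n => //.
  by split; apply: enorm_le_cube; rewrite //= u_sphere.
have u_phi : u (phi n) @[n --> \oo] --> us.
  exact: (cvg_comp _ fst cvg_pair_phi cvg_fst).
have mu_phi : mu (phi n) @[n --> \oo] --> ms.
  exact: (cvg_comp _ snd cvg_pair_phi cvg_snd).
have us_unit : enorm us = 1.
  exact: (enorm_limit_unit (fun n => u_sphere (phi n)) u_phi).
have alpha_phi : alpha (phi n) @[n --> \oo] --> (1 : R).
  apply: (cvg_comp phi alpha _ alpha_cvg1).
  apply/cvgnyPge => N; exists N => // n /= Nn; apply: leq_trans Nn _.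
  by elim: n => // n IH; exact: leq_ltn_trans IH (phi_incr _ _ (ltnSn n)).
have halfline := ae_halfline (fun n => alpha_ge0_lt1 (phi n)) alpha_phi
  (fun n => u_sphere (phi n)) u_phi mu_phi (fun n => mu_quantile (phi n)).
have [|not_conc|int_oo] := P_acc us; first by exists phi.
  exact/not_conc/(ae_halfline_concentrated us_unit halfline).
by have := ae_halfline_finite_integral us_unit halfline; rewrite int_oo ltxx.
Qed.
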